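(* Let $K$ be a field, $k\ge 0$ an integer, $G=\mathcal{G}_{lr}$ and $A=[a_{ij}]\in M_{m,n}^{(k)}$. The algorithm StabEq described in the context terminates and is correct: its output consists of polynomials $D_1,\ldots,D_t\in K[U,V,G]$ such that the variety $V(D_1,\ldots,D_t)$ defined by them in $\mathcal{G}_{lr}^{(k)}$ coincides with the stabilizer $G_A^{(k)}=\{g\in\mathcal{G}_{lr}^{(k)}\mid gA=A\}\subset\mathcal{G}_{lr}^{(k)}$ of $A$.
   Context: $K$ is a field of arbitrary characteristic, $R=K[[x_1,\ldots,x_s]]$, $\mathfrak{m}=\langle x_1,\ldots,x_s\rangle$, $M_{m,n}=Mat(m,n,R)$, and $M_{m,n}^{(k)}=M_{m,n}/\mathfrak{m}^{k+1}M_{m,n}$, identified with $m\times n$ matrices of polynomials of degree at most $k$ in ${\bf x}=(x_1,\ldots,x_s)$; it is an affine space of dimension $t=mn\binom{s+k}{k}$. For a polynomial or power series, $jet_k$ denotes truncation after terms of degree $k$ in ${\bf x}$. $\mathcal{G}_{lr}=(GL(m,R)\times GL(n,R))\rtimes Aut(R)$ acts on $M_{m,n}$ by $(U,V,\phi)\cdot A=U\,\phi(A)\,V$, $\phi(A)=[a_{ij}(\phi(x_1),\ldots,\phi(x_s))]$. $\mathcal{G}_{lr}^{(k)}$ is the affine algebraic group of $k$-jets of elements of $\mathcal{G}_{lr}$, acting on $M_{m,n}^{(k)}$ by letting representatives act and taking $k$-jets. Varieties are considered as sets with the Zariski topology over the algebraic closure $\bar K$, defined over $K$. Algorithm StabEq.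 Input: $k$ and $A=[a_{ij}]\in M_{m,n}^{(k)}$. Step 1. Introduce new variables $U_{ija}$ ($1\le i,j\le m$, $0\le|a|\le k$), $V_{ija}$ ($1\le i,j\le n$, $0\le|a|\le k$), $G_{ij}$ ($1\le i,j\le s$), $H_{ia}$ ($1\le i\le s$, $2\le|a|\le k$), where $a=(a_1,\ldots,a_s)$ are multi-indices; write $U,V,G$ for these collections of variables ($G$ comprising the $G_{ij}$ and $H_{ia}$). In $K[{\bf x},U,V,G]$ define, with $\delta_{ij}$ the Kronecker symbol, $G_i=\sum_{j=1}^s(\delta_{ij}+G_{ij})x_j+\sum_{|a|=2}^kH_{ia}{\bf x}^a$ ($i=1,\ldots,s$), $U_{ij}=\delta_{ij}+U_{ij0}+\sum_{|a|=1}^kU_{ija}{\bf x}^a$ ($i,j=1,\ldots,m$), $V_{ij}=\delta_{ij}+V_{ij0}+\sum_{|a|=1}^kV_{ija}{\bf x}^a$ ($i,j=1,\ldots,n$). With these coordinates $\mathcal{G}_{lr}^{(k)}$ is the complement of the hypersurface $\det(1+[G_{ij}])\det(1+[U_{ij0}])\det(1+[V_{ij0}])=0$ in the affine space with coordinates $U,V,G$, of dimension $(m^2+n^2+s)\binom{s+k}{k}-s$. Step 2. Form the matrix $B=[b_{ij}]=jet_k\left([U_{ij}]\cdot[a_{ij}(G_1,\ldots,G_s)]\cdot[V_{ij}]\right)\in Mat(m,n,K[{\bf x},U,V,G])$, the $k$-jet being taken with respect to ${\bf x}$. Step 3. Write $b_{ij}-a_{ij}=\sum_{|a|=0}^kd_{ija}{\bf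 x}^a$ with $d_{ija}\in K[U,V,G]$, and denote the $t$ polynomials $d_{ija}$ ($1\le i\le m$, $1\le j\le n$, $0\le|a|\le k$) by $D_1,\ldots,D_t$. Step 4. Return $D_1,\ldots,D_t$. *)

(* Defs.v *)
From HB Require Import structures.
From mathcomp Require Import all_boot all_order all_algebra.
From mathcomp Require Import mpoly.
From mathcomp Require Import boolp.

Set Implicit Arguments.
Unset Strict Implicit.
Unset Printing Implicit Defensive.

Import GRing.Theory.
Local Open Scope ring_scope.

(* A formal power series in x_1, ..., x_s is its family of coefficients.  The
   record (rather than a bare function type) keeps the pointwise structures on
   function types from interfering with the Cauchy product. *)
Record mfps (s : nat) (R : Type) := MFPS { fcoef : 'X_{1..s} -> R }.

HB.instance Definition _ (s : nat) (R : Type) := gen_eqMixin (mfps s R).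
HB.instance Definition _ (s : nat) (R : Type) := gen_choiceMixin (mfps s R).

Section SeriesRing.
Variables (s : nat) (R : comNzRingType).
Implicit Types (f g h : mfps s R) (a : 'X_{1..s}) (c : R).

Definition mfps_of_mpoly (p : {mpoly R[s]}) : mfps s R := MFPS (fun a => p@_a).

(* jet_k of a power series, as a polynomial of degree at most k *)
Definition fjet (k : nat) f : {mpoly R[s]} :=
  \sum_(a : 'X_{1..s < k.+1}) fcoef f a *: 'X_[a].

Definition mfps_add f g : mfps s R := MFPS (fun a => fcoef f a + fcoef g a).
Definition mfps_opp f : mfps s R := MFPS (fun a => - fcoef f a).
Definition mfps_mul f g : mfps s R := MFPS (fun a =>
  \sum_(b : 'X_{1..s < (mdeg a).+1, (mdeg a).+1} | a == (b.1 + b.2)%MM)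
     fcoef f b.1 * fcoef g b.2).
Definition mfps_scale c f : mfps s R := MFPS (fun a => c * fcoef f a).

Lemma mfpsP f g : fcoef f =1 fcoef g -> f = g.
Proof. by case: f g => [f] [g] /= /funext ->. Qed.

Lemma mcoeff_fjet k f a :
  (fjet k f)@_a = if (mdeg a <= k)%N then fcoef f a else 0.
Proof.
rewrite /fjet raddf_sum /=; case: ifPn => le_ak.
  rewrite (bigD1 (BMultinom (le_ak : (mdeg a < k.+1)%N))) //=.
  rewrite mcoeffZ mcoeffX eqxx mulr1 big1 ?addr0 // => b /eqP neb.
  rewrite mcoeffZ mcoeffX; case: eqP => [eab|_]; last by rewrite mulr0.
  by case: neb; apply: val_inj.
rewrite big1 // => b _; rewrite mcoeffZ mcoeffX; case: eqP => [eab|_].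
  by move: le_ak; rewrite -eab -ltnS bmdeg.
by rewrite mulr0.
Qed.

Lemma fcoef_mul k f g a : (mdeg a <= k)%N ->
  fcoef (mfps_mul f g) a = (fjet k f * fjet k g)@_a.
Proof.
move=> le_ak; rewrite mcoeffM /=; apply: eq_bigr => -[b1 b2] /= _.
by rewrite !mcoeff_fjet !(leq_trans _ le_ak) // -ltnS bmdeg.
Qed.

Lemma mcoeffM_congr (p p' q q' : {mpoly R[s]}) a :
    (forall b, (mdeg b <= mdeg a)%N -> p@_b = p'@_b) ->
    (forall b, (mdeg b <= mdeg a)%N -> q@_b = q'@_b) ->
  (p * q)@_a = (p' * q')@_a.
Proof.
move=> Ep Eq; rewrite !mcoeffM; apply: eq_bigr => -[b1 b2] /= _.
by rewrite Ep ?Eq // -ltnS bmdeg.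
Qed.

Lemma mfps_addA : associative mfps_add.
Proof. by move=> f g h; apply: mfpsP => a /=; rewrite addrA. Qed.
Lemma mfps_addC : commutative mfps_add.
Proof. by move=> f g; apply: mfpsP => a /=; rewrite addrC. Qed.
Lemma mfps_add0 : left_id (mfps_of_mpoly 0) mfps_add.
Proof. by move=> f; apply: mfpsP => a /=; rewrite mcoeff0 add0r. Qed.
Lemma mfps_addN : left_inverse (mfps_of_mpoly 0) mfps_opp mfps_add.
Proof. by move=> f; apply: mfpsP => a /=; rewrite mcoeff0 addNr. Qed.

HB.instance Definition _ :=
  GRing.isZmodule.Build (mfps s R) mfps_addA mfps_addC mfps_add0 mfps_addN.

Lemma mfps_mulA : associative mfps_mul.
Proof.
move=> f g h; apply: mfpsP => a.
rewrite !(@fcoef_mul (mdeg a)) //.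
transitivity ((fjet (mdeg a) f * (fjet (mdeg a) g * fjet (mdeg a) h))@_a).
  apply: mcoeffM_congr => // b le_ba.
  by rewrite mcoeff_fjet le_ba (@fcoef_mul (mdeg a)).
rewrite mulrA; apply: mcoeffM_congr => // b le_ba.
by rewrite mcoeff_fjet le_ba (@fcoef_mul (mdeg a)).
Qed.

Lemma mfps_mulC : commutative mfps_mul.
Proof.
by move=> f g; apply: mfpsP => a; rewrite !(@fcoef_mul (mdeg a)) // mulrC.
Qed.

Lemma mfps_mul1 : left_id (mfps_of_mpoly 1) mfps_mul.
Proof.
move=> f; apply: mfpsP => a; rewrite (@fcoef_mul (mdeg a)) //.
have -> : fcoef f a = (1 * fjet (mdeg a) f)@_a.
  by rewrite mul1r mcoeff_fjet leqnn.
by apply: mcoeffM_congr => // b le_ba; rewrite mcoeff_fjet le_ba.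
Qed.

Lemma mfps_mulDl : left_distributive mfps_mul +%R.
Proof.
move=> f g h; apply: mfpsP => a.
rewrite [RHS]/= -big_split /=; apply: eq_bigr => b _.
by rewrite mulrDl.
Qed.

Lemma mfps_1_neq0 : mfps_of_mpoly 1 != 0.
Proof.
apply/eqP => /(congr1 (fun f => fcoef f 0%MM)) /= /eqP.
by rewrite mcoeff1 eqxx mcoeff0 oner_eq0.
Qed.

HB.instance Definition _ := GRing.Zmodule_isComNzRing.Build (mfps s R)
  mfps_mulA mfps_mulC mfps_mul1 mfps_mulDl mfps_1_neq0.

Lemma mfps_scaleA c d f : mfps_scale c (mfps_scale d f) = mfps_scale (c * d) f.
Proof. by apply: mfpsP => a /=; rewrite mulrA. Qed.
Lemma mfps_scale1 : left_id 1 mfps_scale.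
Proof. by move=> f; apply: mfpsP => a /=; rewrite mul1r. Qed.
Lemma mfps_scaleDr : right_distributive mfps_scale +%R.
Proof. by move=> c f g; apply: mfpsP => a /=; rewrite mulrDr. Qed.
Lemma mfps_scaleDl f : {morph mfps_scale^~ f : c d / c + d}.
Proof. by move=> c d; apply: mfpsP => a /=; rewrite mulrDl. Qed.

HB.instance Definition _ := GRing.Zmodule_isLmodule.Build R (mfps s R)
  mfps_scaleA mfps_scale1 mfps_scaleDr mfps_scaleDl.

Lemma mfps_scaleAl c f g : c *: (f * g) = c *: f * g.
Proof.
by apply: mfpsP => a /=; rewrite mulr_sumr; apply: eq_bigr => b _; rewrite mulrA.
Qed.

HB.instance Definition _ :=
  GRing.Lmodule_isLalgebra.Build R (mfps s R) mfps_scaleAl.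
HB.instance Definition _ := GRing.Lalgebra_isComAlgebra.Build R (mfps s R).

Definition mfps_unit : pred (mfps s R) := fun f => `[< exists g, g * f = 1 >].
Definition mfps_inv f : mfps s R :=
  if pselect (exists g, g * f = 1) is left e then projT1 (cid e) else f.

Lemma mfps_mulVr : {in mfps_unit, left_inverse 1 mfps_inv *%R}.
Proof.
move=> f /asboolP uf; rewrite /mfps_inv; case: pselect => // e.
exact: projT2 (cid e).
Qed.
Lemma mfps_unitPl f g : g * f = 1 -> mfps_unit f.
Proof. by move=> gf; apply/asboolP; exists g. Qed.
Lemma mfps_invr_out : {in [predC mfps_unit], mfps_inv =1 id}.
Proof.
move=> f /negP uf; rewrite /mfps_inv; case: pselect => // e.
by case: uf; apply/asboolP.
Qed.

HB.instance Definition _ := GRing.ComNzRing_hasMulInverse.Build (mfps s R)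
  mfps_mulVr mfps_unitPl mfps_invr_out.

End SeriesRing.

Section LeftRightGroup.
Variables (s m n : nat) (F : fieldType).

(* Elements (U, V, phi) of (GL(m, R) x GL(n, R)) x| Aut(R), R = F[[x]], where
   Aut(R) consists of the F-algebra automorphisms of R. *)
Record Glr := MkGlr {
  glrU : 'M[mfps s F]_m;
  glrV : 'M[mfps s F]_n;
  glrphi : {lrmorphism mfps s F -> mfps s F};
  glrU_unit : glrU \in unitmx;
  glrV_unit : glrV \in unitmx;
  glrphi_bij : bijective glrphi
}.

Definition glr_act (g : Glr) (A : 'M[mfps s F]_(m, n)) : 'M[mfps s F]_(m, n) :=
  glrU g *m map_mx (glrphi g) A *m glrV g.

(* The class of g . A in M_{m,n}^(k), for A in M_{m,n}^(k): the polynomial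
   matrix A is used as the representative of its class. *)
Definition glr_jet_act (k : nat) (g : Glr) (A : 'M[{mpoly F[s]}]_(m, n)) :
    'M[{mpoly F[s]}]_(m, n) :=
  map_mx (@fjet s F k) (glr_act g (map_mx (@mfps_of_mpoly s F) A)).

End LeftRightGroup.

Section Algorithm.
Variables (s m n k : nat).

(* Index set of the variables U_ija, V_ija, G_ij, H_ia.  As {mpoly _[N]} has
   its variables indexed by 'I_N, it is enumerated by enum_rank. *)
Definition coordinate : Type :=
  ('I_m * 'I_m * 'X_{1..s < k.+1} + 'I_n * 'I_n * 'X_{1..s < k.+1}
   + 'I_s * 'I_s + 'I_s * {a : 'X_{1..s < k.+1} | (2 <= mdeg a)%N})%type.
HB.instance Definition _ := Finite.on coordinate.

Definition idxU i j a : coordinate := inl (inl (inl (i, j, a))).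
Definition idxV i j a : coordinate := inl (inl (inr (i, j, a))).
Definition idxG i j : coordinate := inl (inr (i, j)).
Definition idxH i a : coordinate := inr (i, a).

Variable K : fieldType.

(* K[U, V, G] *)
Local Notation KUVG := {mpoly K[#|{: coordinate}|]}.

Definition cvar (v : coordinate) : KUVG := 'X_(enum_rank v).

(* K[x, U, V, G] is represented as K[U, V, G][x]. *)
Definition genG (i : 'I_s) : {mpoly KUVG[s]} :=
  \sum_(j < s) ((i == j)%:R + cvar (idxG i j)) *: 'X_j
  + \sum_(a : {a : 'X_{1..s < k.+1} | (2 <= mdeg a)%N})
      cvar (idxH i a) *: 'X_[val a].

Definition genU : 'M[{mpoly KUVG[s]}]_m := \matrix_(i, j)
  ((i == j)%:R + \sum_(a : 'X_{1..s < k.+1}) cvar (idxU i j a) *: 'X_[a]).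

Definition genV : 'M[{mpoly KUVG[s]}]_n := \matrix_(i, j)
  ((i == j)%:R + \sum_(a : 'X_{1..s < k.+1}) cvar (idxV i j a) *: 'X_[a]).

Definition hypersurface : KUVG :=
  \det (1%:M + \matrix_(i, j) cvar (idxG i j))
  * \det (1%:M + \matrix_(i, j) cvar (idxU i j bm0))
  * \det (1%:M + \matrix_(i, j) cvar (idxV i j bm0)).

Definition mpjet (R : nzRingType) (d : nat) (p : {mpoly R[s]}) : {mpoly R[s]} :=
  \sum_(a : 'X_{1..s < d.+1}) p@_a *: 'X_[a].

Definition StabEqB (A : 'M[{mpoly K[s]}]_(m, n)) : 'M[{mpoly KUVG[s]}]_(m, n) :=
  map_mx (mpjet k)
    (genU
     *m map_mx (fun p => map_mpoly (@mpolyC _ K) p \mPo [tuple genG i | i < s]) A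
     *m genV).

Definition StabEq (A : 'M[{mpoly K[s]}]_(m, n)) : seq KUVG :=
  [seq (StabEqB A u.1.1 u.1.2 - map_mpoly (@mpolyC _ K) (A u.1.1 u.1.2))@_u.2
     | u : 'I_m * 'I_n * 'X_{1..s < k.+1}].

Section Points.
Variables (Kbar : fieldType) (iota : {rmorphism K -> Kbar}).
Implicit Type p : coordinate -> Kbar.

Definition eval_at p (D : KUVG) : Kbar := mmap iota (fun v => p (enum_val v)) D.

(* The k-jet of g has coordinates p.  The linear part of phi is kept even for
   k = 0, since the coordinates G_ij are present for every k. *)
Definition jet_coordinates (g : Glr s m n Kbar) p : Prop :=
  [/\ map_mx (fjet k) (glrU g) = map_mx (map_mpoly (eval_at p)) genU,
      map_mx (fjet k) (glrV g) = map_mx (map_mpoly (eval_at p)) genV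
    & forall i : 'I_s,
        fjet (maxn k 1) (glrphi g (mfps_of_mpoly 'X_i))
        = map_mpoly (eval_at p) (genG i)].

(* V(Ds) in G_lr^(k), the latter being the complement of the hypersurface *)
Definition variety (Ds : seq KUVG) p : Prop :=
  eval_at p hypersurface != 0 /\ (forall D, D \in Ds -> eval_at p D = 0).

(* p is (the coordinate vector of) a k-jet of an element of G_lr, and acts
   trivially on A, whichever representative of the jet is used. *)
Definition stabilizer (A : 'M[{mpoly Kbar[s]}]_(m, n)) p : Prop :=
  (exists g, jet_coordinates g p)
  /\ (forall g, jet_coordinates g p -> glr_jet_act k g A = A).

End Points.
End Algorithm.

(* Main.v *)
From HB Require Import structures.
Require Import Defs.
From mathcomp Require Import all_boot all_order all_algebra.
From mathcomp Require Import mpoly.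

Set Implicit Arguments.
Unset Strict Implicit.
Unset Printing Implicit Defensive.

Import GRing.Theory.
Local Open Scope ring_scope.

(** The polynomials returned by StabEq are the coefficients of the k-jet of
    the generic product U * A(G) * V minus A.  Evaluating them at a point p
    therefore gives the coefficients of the k-jet of U_p * A(G_p) * V_p minus A.
    Two things have to be checked.

    The first is that this k-jet is that of g . A for every group element g
    whose jet is p ([jet_act_StabEqB]).  The automorphism phi of g is only
    assumed to be an algebra morphism, with no continuity, but the entries of A
    are polynomials, so that phi(a) = a(phi(x_1), ..., phi(x_s)); the rest is
    that the k-jet of a sum or product only depends on the k-jets of its terms,
    that is, a congruence modulo the power k + 1 of the maximal ideal.  Hence
    the D_i vanish at p exactly when g . A = A as k-jets ([StabEq_eq0]).

    The second is that the complement of the hypersurface is exactly the set of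
    jets of group elements ([exists_jet], [jet_hypersurface]).  For U and V this
    says that a power series is invertible if and only if its constant term is
    ([fps_unit]).  For phi it is the formal inverse function theorem
    ([inverse_function]): substitution of power series G_i without constant term
    is bijective if and only if the Jacobian matrix of the G_i at the origin is
    invertible.

    Both facts are reduced to one contraction principle ([near_id_bij]): an
    additive map of K[[x]] that differs from the identity by a map raising the
    order is bijective, its inverse being the sum of a Neumann series.
    For the inverse function theorem, composing on either side with the linear
    substitution by the inverse Jacobian matrix makes the Jacobian the identity,
    and the tool that turns information on the images of the variables into
    information on all of K[[x]] is the decomposition of a series without constant
    term as f = x_1 h_1 + ... + x_s h_s ([mpow_decomp]). *)

(** * The filtration by powers of the ideal of the variables *)

Section Order.
Variables (s : nat) (R : comNzRingType).
Implicit Types (f g h : mfps s R) (p q : {mpoly R[s]}) (a b : 'X_{1..s}).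

Lemma mfps_of_mpoly_is_zmod_morphism :
  zmod_morphism (@mfps_of_mpoly s R).
Proof. by move=> p q; apply: mfpsP => a /=; rewrite mcoeffB. Qed.

Lemma mfps_of_mpoly_is_monoid_morphism :
  monoid_morphism (@mfps_of_mpoly s R).
Proof.
by split=> // p q; apply: mfpsP => a /=; rewrite mcoeffM.
Qed.

Lemma mfps_of_mpoly_is_scalable : scalable (@mfps_of_mpoly s R).
Proof. by move=> c p; apply: mfpsP => a /=; rewrite mcoeffZ. Qed.

HB.instance Definition _ := GRing.isZmodMorphism.Build _ _ (@mfps_of_mpoly s R)
  mfps_of_mpoly_is_zmod_morphism.
HB.instance Definition _ := GRing.isMonoidMorphism.Build _ _ (@mfps_of_mpoly s R)
  mfps_of_mpoly_is_monoid_morphism.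
HB.instance Definition _ := GRing.isScalable.Build R _ _ _ (@mfps_of_mpoly s R)
  mfps_of_mpoly_is_scalable.

(** The projection [fcoef] with its arguments swapped, so that it can carry an
    additive structure. *)
Definition fcoefficient a f := fcoef f a.

Lemma fcoefficient_is_zmod_morphism a : zmod_morphism (fcoefficient a).
Proof. by []. Qed.

HB.instance Definition _ a := GRing.isZmodMorphism.Build _ _ (fcoefficient a)
  (fcoefficient_is_zmod_morphism a).

Lemma fcoef0 a : fcoef (0 : mfps s R) a = 0.
Proof. exact: (raddf0 (fcoefficient a)). Qed.

Lemma fcoef_sum (I : Type) (r : seq I) (P : pred I) (F : I -> mfps s R) a :
  fcoef (\sum_(i <- r | P i) F i) a = \sum_(i <- r | P i) fcoef (F i) a.
Proof. exact: (raddf_sum (fcoefficient a)). Qed.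

Definition fconst f := fcoef f 0%MM.

Lemma fconst_is_zmod_morphism : zmod_morphism fconst.
Proof. by []. Qed.

Lemma fconst_is_monoid_morphism : monoid_morphism fconst.
Proof.
split=> [|f g]; first by rewrite /fconst /= mcoeff1 eqxx.
by rewrite /fconst (@fcoef_mul _ _ 0) ?mdeg0 // rmorphM /= !mcoeff_fjet mdeg0.
Qed.

HB.instance Definition _ := GRing.isZmodMorphism.Build _ _ fconst
  fconst_is_zmod_morphism.
HB.instance Definition _ := GRing.isMonoidMorphism.Build _ _ fconst
  fconst_is_monoid_morphism.

Lemma fconstB f g : fconst (f - g) = fconst f - fconst g.
Proof. by []. Qed.

(** Membership in the d-th power of the ideal (x_1, ..., x_s). *)
Definition mpow d f := forall a, (mdeg a < d)%N -> fcoef f a = 0.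

Lemma mpow1 f : mpow 1 f <-> fconst f = 0.
Proof.
split=> [f1|f0 a]; first by apply: f1; rewrite mdeg0.
by rewrite ltnS leqn0 mdeg_eq0 => /eqP ->.
Qed.

Lemma mpow_eq0 f : (forall d, mpow d f) -> f = 0.
Proof. by move=> fd; apply: mfpsP => a; rewrite (fd (mdeg a).+1) // fcoef0. Qed.

Lemma mpow_le d e f : (d <= e)%N -> mpow e f -> mpow d f.
Proof. by move=> de fe a ad; apply: fe; apply: leq_trans de. Qed.

Lemma mpow_zero d : mpow d (0 : mfps s R).
Proof. by move=> a _; rewrite fcoef0. Qed.

Lemma mpowD d f g : mpow d f -> mpow d g -> mpow d (f + g).
Proof. by move=> fd gd a ad /=; rewrite fd ?gd ?addr0. Qed.

Lemma mpowN d f : mpow d f -> mpow d (- f).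
Proof. by move=> fd a ad /=; rewrite fd ?oppr0. Qed.

Lemma mpowB d f g : mpow d f -> mpow d g -> mpow d (f - g).
Proof. by move=> fd gd; apply: mpowD => //; apply: mpowN. Qed.

Lemma mpowZ d c f : mpow d f -> mpow d (c *: f).
Proof. by move=> fd a ad /=; rewrite fd ?mulr0. Qed.

Lemma mpow_sum d (I : Type) (r : seq I) (P : pred I) (F : I -> mfps s R) :
  (forall i, P i -> mpow d (F i)) -> mpow d (\sum_(i <- r | P i) F i).
Proof.
by move=> Fd; apply: big_ind => //; [exact: mpow_zero | exact: mpowD].
Qed.

Lemma mpowM d e f g : mpow d f -> mpow e g -> mpow (d + e) (f * g).
Proof.
move=> fd ge a ade /=; apply: big1 => -[b c] /= /eqP abc.
have [bd|db] := ltnP (mdeg b) d; first by rewrite fd // mul0r.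
rewrite ge ?mulr0 // ltnNge; apply/negP => ec.
by have := leq_add db ec; rewrite -mdegD -abc leqNgt ade.
Qed.

Lemma mpowMl d f g : mpow d g -> mpow d (f * g).
Proof. by move=> gd; rewrite -[d]add0n; apply: mpowM. Qed.

Lemma mpowMr d f g : mpow d f -> mpow d (f * g).
Proof. by rewrite mulrC; apply: mpowMl. Qed.

Lemma mpow_trans d f g h : mpow d (f - g) -> mpow d (g - h) -> mpow d (f - h).
Proof. by move=> fg gh; rewrite -(subrKA g); apply: mpowD. Qed.

Lemma mpow_sym d f g : mpow d (f - g) -> mpow d (g - f).
Proof. by move=> fg; rewrite -opprB; apply: mpowN. Qed.

Lemma mpow_congrM d f f' g g' :
  mpow d (f - f') -> mpow d (g - g') -> mpow d (f * g - f' * g').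
Proof.
move=> ff gg; have -> : f * g - f' * g' = (f - f') * g + f' * (g - g').
  by rewrite mulrBl mulrBr addrA subrK.
by apply: mpowD; [apply: mpowMr | apply: mpowMl].
Qed.

Lemma mpow_congrX d f f' n : mpow d (f - f') -> mpow d (f ^+ n - f' ^+ n).
Proof.
move=> ff; elim: n => [|n IHn]; first by rewrite !expr0 subrr; apply: mpow_zero.
by rewrite !exprS; apply: mpow_congrM.
Qed.

Lemma mpow_congr_sum d (I : Type) (r : seq I) (P : pred I)
    (F G : I -> mfps s R) : (forall i, P i -> mpow d (F i - G i)) ->
  mpow d (\sum_(i <- r | P i) F i - \sum_(i <- r | P i) G i).
Proof. by move=> FG; rewrite -sumrB; apply: mpow_sum. Qed.

Lemma mpow_congr_prod d (I : Type) (r : seq I) (P : pred I)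
    (F G : I -> mfps s R) : (forall i, P i -> mpow d (F i - G i)) ->
  mpow d (\prod_(i <- r | P i) F i - \prod_(i <- r | P i) G i).
Proof.
move=> FG; apply: (big_ind2 (fun f g => mpow d (f - g))) => //.
  by rewrite subrr; apply: mpow_zero.
by move=> f f' g g'; apply: mpow_congrM.
Qed.

Lemma mpow_fjet d f : mpow d.+1 (f - mfps_of_mpoly (fjet d f)).
Proof.
by move=> a; rewrite ltnS /= mcoeff_fjet => ->; rewrite subrr.
Qed.

(** Bridges the two languages for approximation: equality of jets, in which the
    algorithm is stated, and congruence, which is compatible with products. *)
Lemma eq_fjet d f g : fjet d f = fjet d g <-> mpow d.+1 (f - g).
Proof.
split=> [fg|fg].
  rewrite -(subrKA (mfps_of_mpoly (fjet d f))) {2}fg.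
  by apply: mpowD; [exact: mpow_fjet | apply/mpow_sym/mpow_fjet].
apply/mpolyP => a; rewrite !mcoeff_fjet; case: ifP => // ad.
by apply/eqP; rewrite -subr_eq0; apply/eqP/fg.
Qed.

Lemma fjet_mfps_of_mpoly d p :
  (forall a, (d < mdeg a)%N -> p@_a = 0) -> fjet d (mfps_of_mpoly p) = p.
Proof.
move=> pd; apply/mpolyP => a; rewrite mcoeff_fjet.
by case: leqP => // /pd ->.
Qed.

Definition fvar (i : 'I_s) : mfps s R := mfps_of_mpoly 'X_i.

Lemma mpow_fvar i : mpow 1 (fvar i).
Proof. by apply/mpow1; rewrite /fconst /= mcoeffX mnm1_eq0. Qed.

Lemma fcoef_fvarM i f a :
  fcoef (fvar i * f) a = if (0 < a i)%N then fcoef f (a - U_(i))%MM else 0.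
Proof.
rewrite (@fcoef_mul _ _ (mdeg a)) //.
transitivity (('X_i * fjet (mdeg a) f)@_a).
  by apply: mcoeffM_congr => // b ba; rewrite mcoeff_fjet ba.
case: ifPn => [a_gt0|]; last first.
  rewrite lt0n negbK => /eqP ai0; rewrite mcoeffM big1 // => -[b c] /= /eqP abc.
  rewrite mcoeffX; case: eqP => [ib|]; last by rewrite mul0r.
  by move/mnmP/(_ i): abc; rewrite mnmDE -ib mnm1E eqxx ai0.
have ia : (U_(i) <= a)%MM.
  by apply/mnm_lepP => j; rewrite mnm1E; case: eqP => // <-.
transitivity ((fjet (mdeg a) f * 'X_i)@_(U_(i) + (a - U_(i)))).
  by rewrite addmC submK // mulrC.
by rewrite mcoeffMX mcoeff_fjet mdegB.
Qed.

(** Each monomial of f is charged to the first variable that occurs in it, so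
    that h_j collects the monomials x^a such that x_j x^a involves no variable
    before x_j.  No cancellation takes place in the sum, so the order of
    the h_j is at least that of f minus one, and the constant terms of the h_j are the linear
    coefficients of f. *)
Lemma mpow_decomp f : mpow 1 f -> exists h : 'I_s -> mfps s R,
  [/\ f = \sum_j fvar j * h j,
      forall j, fconst (h j) = fcoef f U_(j)
    & forall d, mpow d.+1 f -> forall j, mpow d (h j)].
Proof.
move=> /mpow1 f0.
pose low (j : 'I_s) a := [forall i : 'I_s, (i < j)%N ==> (a i == 0%N)].
exists (fun j => MFPS (fun a => if low j a then fcoef f (a + U_(j))%MM else 0)).
split.
- apply: mfpsP => a; rewrite fcoef_sum.
  under eq_bigr do rewrite fcoef_fvarM /=.
  have [->|a_neq0] := eqVneq a 0%MM.
    by rewrite [LHS]f0 big1 // => i _; rewrite mnm0E.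
  have [i0 ai0] : exists i, a i != 0%N.
    apply/existsP; apply: contraNT a_neq0; rewrite negb_exists => /forallP a0.
    by apply/eqP/mnmP => i; rewrite mnm0E; apply/eqP; rewrite -[_ == _]negbK.
  case: (@arg_minnP _ i0 (fun i => a i != 0%N) (@nat_of_ord s) ai0).
  move=> j aj jmin.
  have aj_gt0 : (0 < a j)%N by rewrite lt0n.
  have ja : (U_(j) <= a)%MM.
    by apply/mnm_lepP => i; rewrite mnm1E; case: eqP => // <-.
  rewrite (bigD1 j) //= aj_gt0 big1 ?addr0.
    rewrite (submK ja) ifT //; apply/forallP => i; apply/implyP => ij.
    rewrite mnmBE; have [->|ai] := eqVneq (a i) 0%N; first by rewrite sub0n.
    by have := jmin i ai; rewrite leqNgt ij.
  move=> i i_neqj; case: ifP => // ai; case: ifP => // /forallP low_i.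
  have : (j < i)%N.
    by rewrite ltn_neqAle (jmin i) -?lt0n // andbT eq_sym.
  move/(implyP (low_i j)); rewrite mnmBE mnm1E (negbTE i_neqj) subn0.
  by rewrite (negbTE aj).
- move=> j; rewrite /fconst /= add0m ifT //.
  by apply/forallP => i; rewrite mnm0E eqxx implybT.
- move=> d fd j a ad /=; case: ifP => // _.
  by apply: fd; rewrite mdegD mdeg1 addn1 ltnS.
Qed.

End Order.
(** * Contractions and invertible power series *)

Section Contraction.
Variables (s : nat) (R : comNzRingType).
Implicit Types (f g h : mfps s R).
Variable phi : {additive mfps s R -> mfps s R}.
Hypothesis phi_near_id : forall d f, mpow d f -> mpow d.+1 (phi f - f).

Let defect f := f - phi f.
Let neumann n f := \sum_(i < n) iter i defect f.

(** An element h of the kernel equals h - phi(h), so h in the power d of the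
    ideal lies in the power d + 1, for all d. *)
Lemma near_id_inj : injective phi.
Proof.
move=> f g /eqP; rewrite -subr_eq0 -raddfB => /eqP phi0.
apply/eqP; rewrite -subr_eq0; apply/eqP/mpow_eq0; elim=> [|d IHd] //.
by have := mpowN (phi_near_id IHd); rewrite phi0 sub0r opprK.
Qed.

Lemma near_id_mpow d f : mpow d f -> mpow d (phi f).
Proof.
move=> fd; rewrite -(subrK f (phi f)); apply: mpowD => //.
exact: mpow_le (phi_near_id fd).
Qed.

Lemma neumann_tail n f : mpow n (iter n defect f).
Proof.
elim: n => [|n IHn] //=.
by rewrite /defect -opprB; apply: mpowN; apply: phi_near_id.
Qed.

Lemma neumann_telescope n f : phi (neumann n f) = f - iter n defect f.
Proof.
rewrite /neumann; elim: n => [|n IHn]; first by rewrite big_ord0 raddf0 subrr.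
by rewrite big_ord_recr /= raddfD /= IHn /defect opprB addrA addrAC.
Qed.

(** The Neumann series 1 + N + N^2 + ... with N = 1 - phi converges because N
    raises the order; its coefficient at x^a only involves the terms N^i with
    i <= |a|, which makes the limit an explicit series. *)
Lemma near_id_bij : bijective phi.
Proof.
pose psi f := MFPS (fun a => fcoef (neumann (mdeg a).+1 f) a).
have psi_jet d f : mpow d (psi f - neumann d f).
  move=> a ad /=; rewrite /neumann -(subnKC ad) big_split_ord /= opprD addNKr.
  rewrite fcoef_sum; apply/eqP; rewrite oppr_eq0; apply/eqP; apply: big1 => i _.
  by apply: (@neumann_tail ((mdeg a).+1 + i)); rewrite leq_addr.
have psiK : cancel psi phi.
  move=> f; apply/eqP; rewrite -subr_eq0; apply/eqP/mpow_eq0 => d.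
  have -> : phi (psi f) - f = phi (psi f - neumann d f) - iter d defect f.
    by rewrite raddfB /= neumann_telescope -[RHS]addrA -opprD subrK.
  by apply: mpowB; [exact: near_id_mpow | exact: neumann_tail].
exists psi => //; exact: inj_can_sym near_id_inj.
Qed.

End Contraction.

(** After division by the constant term, multiplication by f is within a
    higher-order term of the identity, so 1 is in its image. *)
Lemma fps_unit (s : nat) (R : comUnitRingType) (f : mfps s R) :
  (f \is a GRing.unit) = (fconst f \is a GRing.unit).
Proof.
apply/idP/idP => [|fu]; first exact: (rmorph_unit (@fconst s R)).
pose g := (fconst f)^-1 *: f.
have g1 : mpow 1 (g - 1).
  apply/mpow1; rewrite fconstB (rmorph1 (@fconst s R)) /fconst /=.
  by rewrite mulVr // subrr.
have [gi _ giK] : bijective (g \*o idfun).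
  apply: near_id_bij => d h hd /=.
  rewrite -{2}[h]mul1r -mulrBl -add1n.
  exact: mpowM.
apply/unitrPr; exists ((fconst f)^-1 *: gi 1).
by rewrite -scalerAr scalerAl -[RHS](giK 1).
Qed.

(** * Local algebra morphisms and their Jacobian matrix *)

Section LocalMorphism.
Variables (s : nat) (R : comNzRingType).
Implicit Types (f g h : mfps s R).

Lemma mpow2 f : mpow 1 f -> (forall l, fcoef f U_(l) = 0) -> mpow 2 f.
Proof.
move=> f1 fl a; rewrite ltnS leq_eqVlt => /orP[|]; last exact: f1.
by case/mdeg1P=> l /eqP ->.
Qed.

Lemma mpow_sub_fconst f : mpow 1 (f - (fconst f)%:A).
Proof. by apply/mpow1; rewrite /fconst /= mcoeff1 eqxx mulr1 subrr. Qed.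

Lemma fcoef_linM f g l : mpow 1 f ->
  fcoef (f * g) U_(l) = fcoef f U_(l) * fconst g.
Proof.
move=> f1; have := mpowM f1 (@mpow_sub_fconst g).
move/(_ U_(l)%MM); rewrite mdeg1 mulrBr -scalerAr mulr1 => /(_ isT) /eqP.
by rewrite subr_eq0 => /eqP ->; rewrite /= mulrC.
Qed.

Variable phi : {lrmorphism mfps s R -> mfps s R}.

(** The Jacobian matrix at the origin of (phi(x_1), ..., phi(x_s)). *)
Definition flinear : 'M[R]_s := \matrix_(i, j) fcoef (phi (fvar R i)) U_(j).

Hypothesis phi_local : forall i, mpow 1 (phi (fvar R i)).

Let phiM f g : phi (f * g) = phi f * phi g. Proof. exact: rmorphM. Qed.

Let phi_sum (F : 'I_s -> mfps s R) : phi (\sum_i F i) = \sum_i phi (F i).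
Proof. exact: raddf_sum. Qed.

(** No continuity of phi is assumed: the finite decomposition of f along the
    variables replaces it. *)
Lemma local_mpow d f : mpow d f -> mpow d (phi f).
Proof.
elim: d f => // d IHd f fd.
have [h [fE _ /(_ d fd) hd]] := mpow_decomp (mpow_le (isT : (0 < d.+1)%N) fd).
rewrite fE phi_sum; apply: mpow_sum => i _ /=.
by rewrite phiM -add1n; apply: mpowM; [exact: phi_local | exact: IHd].
Qed.

Lemma local_fconst f : fconst (phi f) = fconst f.
Proof.
have phiA c : phi c%:A = c%:A by rewrite linearZ rmorph1.
have phiB : phi (f - (fconst f)%:A) = phi f - (fconst f)%:A.
  by rewrite -[in RHS]phiA raddfB.
have /mpow1 := local_mpow (@mpow_sub_fconst f).
rewrite phiB fconstB => /eqP; rewrite subr_eq0 => /eqP ->.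
by rewrite /fconst /= mcoeff1 eqxx mulr1.
Qed.

(** With f = sum_j x_j h_j, the linear part of phi(f) is the sum of the linear
    parts of the phi(x_j) weighted by the constant terms of the h_j. *)
Lemma local_chain_rule f l : mpow 1 f ->
  fcoef (phi f) U_(l) = \sum_j fcoef f U_(j) * flinear j l.
Proof.
move=> /mpow_decomp [h [-> h0 _]]; rewrite phi_sum !fcoef_sum.
apply: eq_bigr => i _; rewrite phiM fcoef_linM // local_fconst h0.
by rewrite mxE mulrC.
Qed.

(** Induction on the order, from
    phi(x h) - x h = (phi(x) - x) phi(h) + x (phi(h) - h). *)
Lemma local_near_id : flinear = 1%:M ->
  forall d f, mpow d f -> mpow d.+1 (phi f - f).
Proof.
move=> J1 d f; have x2 i : mpow 2 (phi (fvar R i) - fvar R i).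
  apply: mpow2 => [|l]; first by apply: mpowB => //; apply: mpow_fvar.
  move/matrixP/(_ i l): J1; rewrite !mxE /= mcoeffXU => ->.
  by rewrite subrr.
elim: d f => [|d IHd] f fd.
  by apply/mpow1; rewrite fconstB local_fconst subrr.
have [h [fE _ /(_ d fd) hd]] := mpow_decomp (mpow_le (isT : (0 < d.+1)%N) fd).
rewrite fE phi_sum -sumrB; apply: mpow_sum => i _; rewrite phiM.
set x := fvar R i; have -> : phi x * phi (h i) - x * h i =
    (phi x - x) * phi (h i) + x * (phi (h i) - h i).
  by rewrite mulrBl mulrBr addrA subrK.
apply: mpowD.
  by rewrite -add2n; apply: mpowM (x2 i) _; exact: local_mpow.
by rewrite -add1n; apply: mpowM; [exact: mpow_fvar | exact: IHd].
Qed.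

End LocalMorphism.

(** * Substitution and the formal inverse function theorem *)

Section Substitution.
Variables (s : nat) (R : comNzRingType).
Implicit Types (f g h : mfps s R) (p q : {mpoly R[s]}).

Lemma fjetB k f g : fjet k (f - g) = fjet k f - fjet k g.
Proof.
apply/mpolyP => a; rewrite mcoeffB !mcoeff_fjet; case: ifP => //.
by rewrite subrr.
Qed.

Lemma fjetZ k c f : fjet k (c *: f) = c *: fjet k f.
Proof.
apply/mpolyP => a; rewrite mcoeffZ !mcoeff_fjet; case: ifP => //.
by rewrite mulr0.
Qed.

Lemma fjetM k f g :
  mpow k.+1 (mfps_of_mpoly (fjet k (f * g) - fjet k f * fjet k g)).
Proof.
rewrite rmorphB /= [in X in _ - X]rmorphM.
apply: mpow_trans (mpow_congrM _ _); last first.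
- exact: mpow_fjet.
- exact: mpow_fjet.
by apply/mpow_sym/mpow_fjet.
Qed.

Definition feval (G : 'I_s -> mfps s R) p : mfps s R :=
  mmap (in_alg (mfps s R)) G p.

Variable G : 'I_s -> mfps s R.

HB.instance Definition _ := GRing.RMorphism.copy (feval G)
  (mmap (in_alg (mfps s R)) G).

Lemma fevalZ c p : feval G (c *: p) = c *: feval G p.
Proof. by rewrite /feval mmapZ mulr_algl. Qed.

Hypothesis G_local : forall i, mpow 1 (G i).

Lemma feval_mpow d p : mpow d (mfps_of_mpoly p) -> mpow d (feval G p).
Proof.
move=> pd; rewrite /feval /mmap; apply: mpow_sum => a _.
have [/pd /= ->|da] := ltnP (mdeg a) d.
  by rewrite scale0r mul0r; apply: mpow_zero.
apply: mpowMl; apply: mpow_le da _; rewrite mdegE.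
apply: (big_ind2 (fun e f => mpow e f)) => // [e f e' f'|i _].
  exact: mpowM.
elim: (a i) => // e IHe; rewrite exprS -add1n; exact: mpowM.
Qed.

(** The coefficient at x^a of f(G) only depends on the jet of f of order |a|,
    because the G_i have no constant term.  That hypothesis is an argument, so
    that the algebra morphism structure declared below can be attached to the
    function. *)
Definition fsubst of (forall i, mpow 1 (G i)) := fun f : mfps s R =>
  MFPS (fun a => fcoef (feval G (fjet (mdeg a) f)) a).

Local Notation subst := (fsubst G_local).

Lemma fsubst_jet d f : mpow d.+1 (subst f - feval G (fjet d f)).
Proof.
move=> a; rewrite ltnS => ad.
change (fcoef (feval G (fjet (mdeg a) f) - feval G (fjet d f)) a = 0).
rewrite -raddfB; apply: (@feval_mpow (mdeg a).+1 _ _ _ (ltnSn _)) => b.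
rewrite ltnS /= mcoeffB !mcoeff_fjet => ba.
by rewrite ba (leq_trans ba ad) subrr.
Qed.

Lemma fsubst_is_zmod_morphism : zmod_morphism subst.
Proof. by move=> f g; apply: mfpsP => a /=; rewrite fjetB raddfB. Qed.

Lemma fsubst_is_scalable : scalable subst.
Proof. by move=> c f; apply: mfpsP => a /=; rewrite fjetZ fevalZ. Qed.

Lemma fsubst_is_monoid_morphism : monoid_morphism subst.
Proof.
split=> [|f g].
  apply: mfpsP => a /=; rewrite [fjet _ _]fjet_mfps_of_mpoly ?rmorph1 // => b.
  by rewrite mcoeff1; case: eqP => // ->; rewrite mdeg0.
apply/eqP; rewrite -subr_eq0; apply/eqP/mpow_eq0 => d.
apply: (@mpow_le _ _ _ d.+1) => //.
apply: mpow_trans; first exact: fsubst_jet.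
apply: (@mpow_trans _ _ _ _ (feval G (fjet d f * fjet d g))).
  by rewrite -raddfB; apply/feval_mpow/fjetM.
by rewrite rmorphM; apply: mpow_congrM; apply/mpow_sym/fsubst_jet.
Qed.

HB.instance Definition _ := GRing.isZmodMorphism.Build _ _ subst
  fsubst_is_zmod_morphism.
HB.instance Definition _ := GRing.isMonoidMorphism.Build _ _ subst
  fsubst_is_monoid_morphism.
HB.instance Definition _ := GRing.isScalable.Build R _ _ _ subst
  fsubst_is_scalable.

Lemma fsubst_fvar i : subst (fvar R i) = G i.
Proof.
apply/eqP; rewrite -subr_eq0; apply/eqP/mpow_eq0 => d.
apply: (@mpow_le _ _ _ d.+2); first by rewrite leqW.
apply: mpow_trans; first exact: fsubst_jet.
rewrite fjet_mfps_of_mpoly.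
  by rewrite /feval mmapX mmap1U subrr; apply: mpow_zero.
by move=> a; rewrite mcoeffX; case: eqP => // <-; rewrite mdeg1.
Qed.

End Substitution.

Section InverseFunction.
Variables (s : nat) (R : comUnitRingType).

Lemma exists_substitution (G : 'I_s -> mfps s R) :
    (forall i, mpow 1 (G i)) ->
  exists phi : {lrmorphism mfps s R -> mfps s R},
    forall i, phi (fvar R i) = G i.
Proof. by move=> G1; exists (fsubst G1); exact: fsubst_fvar. Qed.

Lemma flinear_comp (phi psi : {lrmorphism mfps s R -> mfps s R}) :
    (forall i, mpow 1 (phi (fvar R i))) ->
    (forall i, mpow 1 (psi (fvar R i))) ->
  flinear (psi \o phi) = flinear phi *m flinear psi.
Proof.
move=> phi1 psi1; apply/matrixP => i l; rewrite !mxE /= local_chain_rule //.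
by apply: eq_bigr => j _; rewrite !mxE.
Qed.

(** If phi is bijective, the linear coefficients of the preimages of the x_i
    form an inverse of the Jacobian, by the chain rule.  Conversely let psi be
    the linear substitution by the inverse of the Jacobian matrix of phi: the
    Jacobians of phi o psi and psi o phi are the identity, so both composites
    are bijective by contraction, hence so is phi. *)
Lemma inverse_function (phi : {lrmorphism mfps s R -> mfps s R}) :
    (forall i, mpow 1 (phi (fvar R i))) ->
  bijective phi <-> flinear phi \in unitmx.
Proof.
move=> phi1; split=> [[psi _ psiK]|Ju].
  pose C : 'M[R]_s := \matrix_(i, j) fcoef (psi (fvar R i)) U_(j).
  suff /mulmx1_unit[] : C *m flinear phi = 1%:M by [].
  apply/matrixP => i l; rewrite !mxE -mcoeffXU.
  have -> : ('X_i : {mpoly R[s]})@_U_(l) = fcoef (phi (psi (fvar R i))) U_(l).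
    by rewrite psiK.
  rewrite local_chain_rule //; first by apply: eq_bigr => j _; rewrite mxE.
  by apply/mpow1; rewrite -(local_fconst phi1) psiK; apply/mpow1/mpow_fvar.
have [|psi psiE] := @exists_substitution
    (fun i => \sum_j invmx (flinear phi) i j *: fvar R j).
  by move=> i; apply: mpow_sum => j _; apply/mpowZ/mpow_fvar.
have psi1 i : mpow 1 (psi (fvar R i)).
  by rewrite psiE; apply: mpow_sum => j _; apply/mpowZ/mpow_fvar.
have Jpsi : flinear psi = invmx (flinear phi).
  apply/matrixP => i l.
  rewrite mxE psiE fcoef_sum (bigD1 l) //= big1 => [|j jl].
    by rewrite mcoeffXU eqxx mulr1 addr0.
  by rewrite mcoeffXU (negbTE jl) mulr0.
have [u _ uK] : bijective (phi \o psi).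
  apply: near_id_bij; apply: local_near_id => [i|].
    exact: (local_mpow phi1).
  by rewrite flinear_comp // Jpsi mulVmx.
have [v vK _] : bijective (psi \o phi).
  apply: near_id_bij; apply: local_near_id => [i|].
    exact: (local_mpow psi1).
  by rewrite flinear_comp // Jpsi mulmxV.
exists (psi \o u) => [f|]; last exact: uK.
by apply: (can_inj vK); rewrite /= [phi _](uK (phi f)).
Qed.

End InverseFunction.

(** * The generic group element and its evaluation at a point *)

Lemma mcoeff_mpjet (s : nat) (R : comNzRingType) d (q : {mpoly R[s]}) a :
  (mpjet d q)@_a = if (mdeg a <= d)%N then q@_a else 0.
Proof. exact: (mcoeff_fjet d (mfps_of_mpoly q) a). Qed.

Lemma mpow_congr_mulmx (s : nat) (R : comNzRingType) d (m n r : nat)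
    (M M' : 'M[mfps s R]_(m, n)) (N N' : 'M[mfps s R]_(n, r)) :
    (forall i j, mpow d (M i j - M' i j)) ->
    (forall i j, mpow d (N i j - N' i j)) ->
  forall i j, mpow d ((M *m N) i j - (M' *m N') i j).
Proof.
move=> MM' NN' i j; rewrite !mxE.
by apply: mpow_congr_sum => l _; apply: mpow_congrM.
Qed.

Section Realization.
Variables (s m n k : nat) (K F : fieldType) (iota : {rmorphism K -> F}).
Variable p : coordinate s m n k -> F.

Local Notation ev := (eval_at iota p).

HB.instance Definition _ := GRing.RMorphism.copy ev
  (mmap iota (fun v => p (enum_val v))).

Lemma eval_at_cvar v : ev (cvar K v) = p v.
Proof. by rewrite /eval_at mmapX mmap1U enum_rankK. Qed.

Lemma eval_at_mpolyC c : ev c%:MP = iota c.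
Proof. by rewrite /eval_at mmapC. Qed.

Local Notation evx := (map_mpoly ev).

Lemma mcoeff_bsum (R : nzRingType) d (c : 'X_{1..s < d} -> R) b :
  (\sum_a c a *: 'X_[a])@_b = if insub b is Some a then c a else 0.
Proof.
rewrite raddf_sum /=; case: insubP => [a _ <-|bd].
  rewrite (bigD1 a) //= mcoeffZ mcoeffX eqxx mulr1 big1 ?addr0 //.
  move=> a' /eqP aa'; rewrite mcoeffZ mcoeffX.
  by case: eqP => [/val_inj //|]; rewrite mulr0.
apply: big1 => a _; rewrite mcoeffZ mcoeffX.
case: eqP => [ab|]; last by rewrite mulr0.
by move: bd; rewrite -ab bmdeg.
Qed.

Lemma mcoeff_bsum_high (R : nzRingType) d (c : 'X_{1..s < d} -> R) b :
  (d <= mdeg b)%N -> (\sum_a c a *: 'X_[a])@_b = 0.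
Proof. by move=> db; rewrite mcoeff_bsum insubF // ltnNge db. Qed.

Lemma genU_high i j (a : 'X_{1..s}) :
  (k < mdeg a)%N -> (genU s m n k K i j)@_a = 0.
Proof.
move=> ka; rewrite mxE mcoeffD mcoeff_bsum_high // addr0 mcoeffMn mcoeff1.
by rewrite -mdeg_eq0 gtn_eqF ?mul0rn // (leq_ltn_trans _ ka).
Qed.

Lemma genV_high i j (a : 'X_{1..s}) :
  (k < mdeg a)%N -> (genV s m n k K i j)@_a = 0.
Proof.
move=> ka; rewrite mxE mcoeffD mcoeff_bsum_high // addr0 mcoeffMn mcoeff1.
by rewrite -mdeg_eq0 gtn_eqF ?mul0rn // (leq_ltn_trans _ ka).
Qed.

Lemma genU_const i j :
  (genU s m n k K i j)@_0%MM = (i == j)%:R + cvar K (idxU n i j bm0).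
Proof.
rewrite mxE mcoeffD mcoeffMn mcoeff1 eqxx; congr (_ + _).
rewrite mcoeff_bsum (_ : insub _ = Some bm0) //.
by rewrite -[0%MM]/(val (@bm0 s k)) valK.
Qed.

Lemma genV_const i j :
  (genV s m n k K i j)@_0%MM = (i == j)%:R + cvar K (idxV m i j bm0).
Proof.
rewrite mxE mcoeffD mcoeffMn mcoeff1 eqxx; congr (_ + _).
rewrite mcoeff_bsum (_ : insub _ = Some bm0) //.
by rewrite -[0%MM]/(val (@bm0 s k)) valK.
Qed.

Lemma genG_nonlinear (i : 'I_s) (a : 'X_{1..s}) :
    (mdeg a < 2)%N || (k < mdeg a)%N ->
  (\sum_(b : {a : 'X_{1..s < k.+1} | (2 <= mdeg a)%N})
      cvar K (idxH m n i b) *: 'X_[val b])@_a = 0.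
Proof.
move=> a_out; rewrite raddf_sum big1 //= => b _; rewrite mcoeffZ mcoeffX.
case: eqP => [ba|]; last by rewrite mulr0.
by move: a_out; rewrite -ba ltnNge (valP b) ltnNge -ltnS bmdeg.
Qed.

Lemma genG_const (i : 'I_s) : (genG m n k K i)@_0%MM = 0.
Proof.
rewrite mcoeffD genG_nonlinear ?mdeg0 // addr0 raddf_sum big1 // => j _ /=.
by rewrite mcoeffZ mcoeffX mnm1_eq0 mulr0.
Qed.

Lemma genG_linear (i j : 'I_s) :
  (genG m n k K i)@_U_(j) = (i == j)%:R + cvar K (idxG m n k i j).
Proof.
rewrite mcoeffD genG_nonlinear ?mdeg1 // addr0 raddf_sum (bigD1 j) //=.
rewrite mcoeffZ mcoeffXU eqxx mulr1 big1 ?addr0 // => l lj.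
by rewrite mcoeffZ mcoeffXU (negbTE lj) mulr0.
Qed.

(** The bound is at least 1 because the linear part is present even for k = 0. *)
Lemma genG_high (i : 'I_s) (a : 'X_{1..s}) :
  (maxn k 1 < mdeg a)%N -> (genG m n k K i)@_a = 0.
Proof.
rewrite gtn_max => /andP[ka a1]; rewrite mcoeffD genG_nonlinear ?ka ?orbT //.
rewrite addr0 raddf_sum big1 // => j _ /=; rewrite mcoeffZ mcoeffX.
rewrite [_ == a]negbTE ?mulr0 //; apply: contraTneq a1 => <-.
by rewrite mdeg1.
Qed.

Definition linear_partG := \matrix_(i, j) ((i == j)%:R + p (idxG m n k i j)).
Definition const_partU := \matrix_(i, j) ((i == j)%:R + p (idxU n i j bm0)).
Definition const_partV := \matrix_(i, j) ((i == j)%:R + p (idxV m i j bm0)).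

Lemma eval_genU_const i j :
  (evx (genU s m n k K i j))@_0%MM = const_partU i j.
Proof.
rewrite mcoeff_map_mpoly /= genU_const rmorphD rmorph_nat /= eval_at_cvar.
by rewrite mxE.
Qed.

Lemma eval_genV_const i j :
  (evx (genV s m n k K i j))@_0%MM = const_partV i j.
Proof.
rewrite mcoeff_map_mpoly /= genV_const rmorphD rmorph_nat /= eval_at_cvar.
by rewrite mxE.
Qed.

Lemma eval_genG_const (i : 'I_s) : (evx (genG m n k K i))@_0%MM = 0.
Proof. by rewrite mcoeff_map_mpoly genG_const raddf0. Qed.

Lemma eval_genG_linear (i j : 'I_s) :
  (evx (genG m n k K i))@_U_(j) = linear_partG i j.
Proof.
rewrite mcoeff_map_mpoly /= genG_linear rmorphD rmorph_nat /= eval_at_cvar.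
by rewrite mxE.
Qed.

Lemma eval_hypersurface : (ev (hypersurface s m n k K) != 0) =
  [&& linear_partG \in unitmx, const_partU \in unitmx & const_partV \in unitmx].
Proof.
rewrite /hypersurface !rmorphM /= -!det_map_mx !mulf_eq0 !negb_or -andbA.
rewrite !unitmxE !unitfE.
by congr [&& _, _ & _]; congr (_ != 0); congr (\det _); apply/matrixP => i j;
  rewrite !mxE rmorphD rmorph_nat /= eval_at_cvar.
Qed.

Lemma unitmx_fconst d (M : 'M[mfps s F]_d) :
  (M \in unitmx) = (map_mx (@fconst s F) M \in unitmx).
Proof. by rewrite !unitmxE fps_unit -det_map_mx. Qed.

(** The generic element evaluated at p is itself the required group element:
    its entries are polynomials of degree at most k (at most max(k, 1) for the
    automorphism), hence equal to their own jets. *)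
Lemma exists_jet :
  ev (hypersurface s m n k K) != 0 ->
  exists g : Glr s m n F, jet_coordinates iota g p.
Proof.
rewrite eval_hypersurface => /and3P[Gu Uu Vu].
pose U := map_mx (@mfps_of_mpoly s F) (map_mx evx (genU s m n k K)).
pose V := map_mx (@mfps_of_mpoly s F) (map_mx evx (genV s m n k K)).
have U_unit : U \in unitmx.
  rewrite unitmx_fconst; congr (_ \in unitmx): Uu; apply/matrixP => i j.
  by rewrite -eval_genU_const [RHS]mxE [U i j]mxE [map_mx _ _ _ _]mxE.
have V_unit : V \in unitmx.
  rewrite unitmx_fconst; congr (_ \in unitmx): Vu; apply/matrixP => i j.
  by rewrite -eval_genV_const [RHS]mxE [V i j]mxE [map_mx _ _ _ _]mxE.
have G1 i : mpow 1 (mfps_of_mpoly (evx (genG m n k K i))).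
  by apply/mpow1; exact: eval_genG_const.
have [phi phiE] := exists_substitution G1.
have phi_bij : bijective phi.
  apply/inverse_function => [i|]; first by rewrite phiE.
  congr (_ \in unitmx): Gu; apply/matrixP => i j.
  by rewrite [RHS]mxE phiE [RHS]eval_genG_linear.
exists (MkGlr U_unit V_unit phi_bij); split=> /=.
- apply/matrixP => i j; rewrite 2!mxE fjet_mfps_of_mpoly.
    by rewrite [in RHS]mxE mxE.
  by move=> a ka; rewrite mxE mcoeff_map_mpoly genU_high ?raddf0.
- apply/matrixP => i j; rewrite 2!mxE fjet_mfps_of_mpoly.
    by rewrite [in RHS]mxE mxE.
  by move=> a ka; rewrite mxE mcoeff_map_mpoly genV_high ?raddf0.
- move=> i; rewrite [phi _]phiE fjet_mfps_of_mpoly // => a ka.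
  by rewrite mcoeff_map_mpoly genG_high ?raddf0.
Qed.

Lemma mcoeff_of_fjet d (f : mfps s F) a : (mdeg a <= d)%N ->
  fcoef f a = (fjet d f)@_a.
Proof. by move=> ad; rewrite mcoeff_fjet ad. Qed.

Lemma jet_hypersurface (g : Glr s m n F) :
  jet_coordinates iota g p -> ev (hypersurface s m n k K) != 0.
Proof.
case=> gU gV gG; rewrite eval_hypersurface; apply/and3P; split.
- have phi1 i : mpow 1 (glrphi g (fvar F i)).
    apply/mpow1; rewrite /fconst (@mcoeff_of_fjet (maxn k 1)) ?mdeg0 // gG.
    exact: eval_genG_const.
  have /inverse_function := glrphi_bij g; move=> /(_ phi1).
  congr (_ \in unitmx); apply/matrixP => i j; rewrite mxE.
  rewrite (@mcoeff_of_fjet (maxn k 1)) ?mdeg1 ?leq_maxr // gG.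
  exact: eval_genG_linear.
- have := glrU_unit g; rewrite unitmx_fconst.
  congr (_ \in unitmx); apply/matrixP => i j; move/matrixP/(_ i j): gU.
  rewrite [map_mx _ _ _ _]mxE [RHS]mxE [in X in _ -> X]mxE /fconst.
  by rewrite (@mcoeff_of_fjet k) ?mdeg0 // => ->; rewrite eval_genU_const.
- have := glrV_unit g; rewrite unitmx_fconst.
  congr (_ \in unitmx); apply/matrixP => i j; move/matrixP/(_ i j): gV.
  rewrite [map_mx _ _ _ _]mxE [RHS]mxE [in X in _ -> X]mxE /fconst.
  by rewrite (@mcoeff_of_fjet k) ?mdeg0 // => ->; rewrite eval_genV_const.
Qed.

(** On a monomial both sides are the same product of powers, taken at phi(x_i)
    and at G_i respectively, and these are congruent. *)
Lemma substitution_jet (g : Glr s m n F) (q : {mpoly K[s]}) :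
    jet_coordinates iota g p ->
  mpow k.+1 (glrphi g (mfps_of_mpoly (map_mpoly iota q))
    - mfps_of_mpoly (evx (map_mpoly (@mpolyC _ K) q
                            \mPo [tuple genG m n k K i | i < s]))).
Proof.
case=> _ _ gG; elim/mpolyind: q => [|c a q _ _ IHq].
  by rewrite !rmorph0 subrr; apply: mpow_zero.
rewrite !rmorphD /= opprD addrACA; apply: mpowD; last exact: IHq.
rewrite !map_mpolyZ !map_mpolyX comp_mpolyZ comp_mpolyX map_mpolyZ /=.
rewrite eval_at_mpolyC.
rewrite !linearZZ -scalerDr /=; apply: mpowZ; rewrite mpolyXE_id !rmorph_prod.
apply: mpow_congr_prod => i _; rewrite !rmorphXn tnth_mktuple.
apply: mpow_congrX.
have := @mpow_fjet _ _ (maxn k 1) (glrphi g (mfps_of_mpoly 'X_i)); rewrite gG.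
by apply: mpow_le; rewrite ltnS leq_maxl.
Qed.

(** The left side depends on g, the right side only on its jet p: this is what
    makes the action on jets well defined and computed by the algorithm. *)
Lemma jet_act_StabEqB (g : Glr s m n F) (A : 'M[{mpoly K[s]}]_(m, n)) :
    jet_coordinates iota g p ->
  glr_jet_act k g (map_mx (map_mpoly iota) A) = map_mx evx (StabEqB k A).
Proof.
move=> gp; have [gU gV _] := gp; apply/matrixP => i j.
rewrite mxE [RHS]mxE [StabEqB _ _ _ _]mxE.
have jet_ev q : evx (mpjet k q) = fjet k (mfps_of_mpoly (evx q)).
  apply/mpolyP => a; rewrite mcoeff_fjet /= !mcoeff_map_mpoly.
  by rewrite mcoeff_mpjet; case: ifP => // _; rewrite raddf0.
rewrite jet_ev; apply/eq_fjet.
set M := _ *m _; have -> : mfps_of_mpoly (evx (M i j)) =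
    map_mx (@mfps_of_mpoly s F) (map_mx evx M) i j.
  by rewrite [RHS]mxE [map_mx _ _ _ _]mxE.
rewrite /M !map_mxM; apply: mpow_congr_mulmx => [|l l'].
  apply: mpow_congr_mulmx => l l'.
    rewrite [map_mx _ _ _ _]mxE -gU [map_mx _ _ _ _]mxE; exact: mpow_fjet.
  by rewrite !mxE; apply: substitution_jet.
rewrite [map_mx _ _ _ _]mxE -gV [map_mx _ _ _ _]mxE; exact: mpow_fjet.
Qed.

(** The coefficients up to degree k are the values of the output; beyond degree
    k both sides vanish, the left one as a jet and the right one by the bound on
    the degrees of A. *)
Lemma StabEq_eq0 (A : 'M[{mpoly K[s]}]_(m, n)) :
    (forall i j, (msize (A i j) <= k.+1)%N) ->
  (forall D, D \in StabEq k A -> ev D = 0) <->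
  map_mx evx (StabEqB k A) = map_mx (map_mpoly iota) A.
Proof.
move=> A_jet.
have evD i j a : ev ((StabEqB k A i j - map_mpoly (@mpolyC _ K) (A i j))@_a)
    = (evx (StabEqB k A i j))@_a - (map_mpoly iota (A i j))@_a.
  by rewrite mcoeffB rmorphB /= !mcoeff_map_mpoly /= eval_at_mpolyC.
split=> [D0|BA D /imageP[[[i j] a] _ ->] /=]; last first.
  by rewrite evD; move/matrixP/(_ i j): BA; rewrite !mxE => ->; rewrite subrr.
apply/matrixP => i j; apply/mpolyP => a.
rewrite [map_mx evx _ _ _]mxE [map_mx _ A _ _]mxE.
have [ak|ka] := leqP (mdeg a) k.
  apply/eqP; rewrite -subr_eq0 -evD; apply/eqP/D0/imageP.
  by exists (i, j, BMultinom (ak : (mdeg a < k.+1)%N)).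
rewrite !mcoeff_map_mpoly [StabEqB _ _ _ _]mxE.
rewrite mcoeff_mpjet leqNgt ka raddf0.
have /eqP -> : (A i j)@_a == 0.
  by rewrite mcoeff_eq0; apply: msize_mdeg_ge; apply: leq_trans (A_jet i j) ka.
by rewrite raddf0.
Qed.

End Realization.

(** * Number of equations and correctness *)

(** Exponent vectors are identified with the tuples over {0, ..., k} of sum at
    most k. *)
Lemma card_bmultinom s k : #|{: 'X_{1..s < k.+1}}| = 'C(s + k, k).
Proof.
rewrite -(@bin_sub _ k) ?leq_addl // addnK -card_partial_ord_partitions.
pose t (a : 'X_{1..s < k.+1}) : s.-tuple 'I_k.+1 := [tuple inord (a i) | i < s].
have a_le (a : 'X_{1..s < k.+1}) i : (a i < k.+1)%N.
  by apply: leq_ltn_trans (bmdeg a); rewrite mdegE (bigD1 i) //= leq_addr.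
have t_inj : injective t.
  move=> a b /(congr1 (fun u i => val (tnth u i))) tab; apply/val_inj/mnmP => i.
  by move/(congr1 (@^~ i)): tab; rewrite /= !tnth_mktuple !inordK.
rewrite -(card_image t_inj); apply: eq_card => u; rewrite !inE.
apply/imageP/idP => [[a _ ->]|u_le].
  rewrite big_tuple (eq_bigr (fun i => a i : nat)) => [|i _].
    by rewrite -mdegE -ltnS bmdeg.
  by rewrite tnth_mktuple inordK.
have ub : (mdeg [multinom val (tnth u i) | i < s] < k.+1)%N.
  rewrite ltnS mdegE; move: u_le; rewrite big_tuple.
  by under [in X in _ -> X]eq_bigr do rewrite mnmE.
exists (BMultinom ub) => //; apply: eq_from_tnth => i.
by rewrite tnth_mktuple /= mnmE inord_val.
Qed.

Theorem mainTheorem5 (K : fieldType)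
    (Kbar : closedFieldType) (iota : {rmorphism K -> Kbar})
    (Kbar_algebraic : forall z : Kbar, algebraicOver iota z)
    (s m n k : nat) (A : 'M[{mpoly K[s]}]_(m, n))
    (A_jet : forall i j, (msize (A i j) <= k.+1)%N) :
  size (StabEq k A) = (m * n * 'C(s + k, k))%N
  /\ (forall p : coordinate s m n k -> Kbar,
        variety iota (StabEq k A) p
        <-> stabilizer iota (map_mx (map_mpoly iota) A) p).
Proof.
split; first by rewrite size_image !card_prod !card_ord card_bmultinom.
move=> p; split=> [[hyp0 D0]|[[g gp] stab]].
  split; first exact: exists_jet.
  move=> g gp; rewrite (jet_act_StabEqB A gp); exact/StabEq_eq0.
split; first exact: jet_hypersurface gp.
by apply/StabEq_eq0 => //; rewrite -(jet_act_StabEqB A gp) stab.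
Qed.
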